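(* Define the linear map $\Phi:\mathbf{H}_{po}\to\mathbf{WQSym}^{\ast}$ by $\Phi((F,\sigma))=\sum_{\tau\in Surj_{|F|_v}}\mathrm{card}\big(\mathbb{S}^{\tau}_{(F,\sigma)}\big)\,\tau$ for every preordered forest $(F,\sigma)$ (with $\Phi(1)=1$). Then $\Phi$ is a Hopf algebra morphism, homogeneous of degree $0$.
   Context: $\mathbb{K}$ is a field of characteristic zero. Rooted forests (up to isomorphism), the relation $v\twoheadrightarrow w$ (oriented path, possibly of length $0$, towards the root), preordered forests $(F,\sigma)$ with $\sigma:V(F)\to\{1,\dots,q\}$ surjective, and the Hopf algebra $\mathbf{H}_{po}$ are as follows: product of $(F,\sigma^F),(G,\sigma^G)$ is the disjoint union with $\sigma^F$ on $V(F)$ and $\sigma^G+\max\sigma^F$ on $V(G)$; coproduct $\Delta(F)=\sum_{\boldsymbol v}Lea_{\boldsymbol v}(F)\otimes Roo_{\boldsymbol v}(F)$ over admissible cuts $\boldsymbol v\subseteq V(F)$ (no two distinct elements related by $\twoheadrightarrow$), $Lea_{\boldsymbol v}(F)$ being the subforest induced on $\{w:\exists v\in\boldsymbol v, w\twoheadrightarrow v\}$ and $Roo_{\boldsymbol v}(F)$ on the other vertices, each with the restricted preorder. $|F|_v$ is the number of vertices. For $n\ge0$, $Surj_n$ is the set of maps $\tau:\{1,\dots,n\}\to\mathbb{N}^*$ with image $\{1,\dots,k\}$ for some $k=\max(\tau)$, written as packed words $(\tau(1)\dots\tau(n))$. $\mathbf{WQSym}^*$ has basis $\bigsqcup_n Surj_n$;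 the product of $\sigma\in Surj_k$ and $\tau\in Surj_l$ is the sum of all shuffles of the word $\sigma(1)\dots\sigma(k)$ with the word $(\tau(1)+\max\sigma)\dots(\tau(l)+\max\sigma)$; the coproduct is $\Delta(\tau)=\sum_{i=0}^n pack(\tau(1)\dots\tau(i))\otimes pack(\tau(i+1)\dots\tau(n))$, where $pack$ replaces each letter by its rank among the distinct letters of the word. For a preordered forest $(F,\sigma)$ with $n$ vertices and $\tau\in Surj_n$, $\mathbb{S}^\tau_{(F,\sigma)}$ is the set of bijections $\varphi:V(F)\to\{1,\dots,n\}$ such that $\sigma(v)=\tau(\varphi(v))$ for all $v$, and $v'\twoheadrightarrow v$ implies $\varphi(v)\ge\varphi(v')$. *)

(* Defs.v *)
From HB Require Import structures.
From mathcomp Require Import all_boot all_algebra finmap.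
From mathcomp.multinomials Require Import monalg.

Set Implicit Arguments.
Unset Strict Implicit.
Unset Printing Implicit Defensive.

Import GRing.Theory.

Local Open Scope ring_scope.

(** * Packed words *)

Definition maxl (s : seq nat) : nat := (\max_(i <- s) i)%N.

(** The set of letters of [s] is {1, ..., max s}. *)
Definition packed (s : seq nat) : bool :=
  all (leq 1) s && all [in s] (iota 1 (maxl s)).

(** The rank of a letter among the distinct letters of [s], counted from 1. *)
Definition rank_in (s : seq nat) (x : nat) : nat :=
  count (fun y => (y <= x)%N) (undup s).

Definition pack (s : seq nat) : seq nat := map (rank_in s) s.

Lemma leq_maxl s x : x \in s -> (x <= maxl s)%N.
Proof. move=> xs; exact: (@leq_bigmax_seq _ s xpredT id x). Qed.

Lemma packedP s : reflect (s =i iota 1 (maxl s)) (packed s).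
Proof.
apply: (iffP andP) => [[/allP s_gt0 /allP s_surj] x|sE].
  apply/idP/idP => [xs|/s_surj //].
  rewrite mem_iota add1n ltnS s_gt0 //=.
  exact: leq_maxl.
split; apply/allP => x; last by rewrite /= sE.
by rewrite sE mem_iota => /andP[].
Qed.

Lemma eq_maxl s t : s =i t -> maxl s = maxl t.
Proof. by move=> st; apply: eq_big_idem => //; apply: maxnn. Qed.

Lemma eq_packed s t : s =i t -> packed s = packed t.
Proof.
move=> st; apply/packedP/packedP => sE x; first by rewrite -(eq_maxl st) -st sE.
by rewrite (eq_maxl st) st sE.
Qed.

Lemma pack_packed s : packed (pack s).
Proof.
have rank_gt0 x : x \in s -> (0 < rank_in s x)%N.
  by move=> xs; rewrite -has_count; apply/hasP; exists x; rewrite ?mem_undup.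
apply/andP; split.
  by apply/allP => _ /mapP[x xs ->]; apply: rank_gt0.
have rank_le x : (rank_in s x <= size (undup s))%N by apply: count_size.
set t := sort leq (undup s).
have tE : t =i s by move=> x; rewrite mem_sort mem_undup.
have t_uniq : uniq t by rewrite sort_uniq undup_uniq.
have t_sorted : sorted ltn t.
  by rewrite ltn_sorted_uniq_leq t_uniq; apply: sort_sorted; apply: leq_total.
have size_t : size t = size (undup s) by rewrite size_sort.
apply/allP => k; rewrite mem_iota add1n ltnS => /andP[k_gt0 k_le].
have k_size : (k.-1 < size t)%N.
  rewrite prednK // size_t; apply: leq_trans k_le _.
  by apply/bigmax_leqP_seq => _ /mapP[x _ ->] _.
apply/mapP; exists (nth 0 t k.-1); first by rewrite -tE mem_nth.
rewrite /rank_in -(permP (_ : perm_eq t (undup s))); last by rewrite perm_sort.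
rewrite -[t in count _ t](cat_take_drop k) count_cat.
have size_take_k : size (take k t) = k.
  by rewrite size_takel // -(prednK k_gt0).
have t_lt := sorted_ltn_nth ltn_trans 0 t_sorted.
rewrite (_ : count _ (take k t) = k); last first.
  rewrite -[RHS]size_take_k; apply/eqP; rewrite -all_count.
  apply/(all_nthP 0) => i; rewrite size_take_k => ik; rewrite nth_take //.
  have: (i <= k.-1)%N by rewrite -ltnS prednK.
  rewrite leq_eqVlt => /predU1P[->//|ik'].
  by apply: ltnW; apply: t_lt; rewrite ?inE //; apply: ltn_trans ik' _.
rewrite (_ : count _ (drop k t) = 0) ?addn0 //.
apply/eqP; rewrite -leqn0 leqNgt -has_count; apply/hasPn => y.
case/(nthP 0) => i; rewrite size_drop ltn_subRL => ik <-.
rewrite nth_drop -ltnNge; apply: t_lt; rewrite ?inE //.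
by rewrite -(prednK k_gt0) addSn ltnS leq_addr.
Qed.

Lemma pack_id s : packed s -> pack s = s.
Proof.
move=> /packedP sE; rewrite -[RHS]map_id; apply/eq_in_map => x xs.
have uE : perm_eq (undup s) (iota 1 (maxl s)).
  by apply: uniq_perm; rewrite ?undup_uniq ?iota_uniq // => y; rewrite mem_undup sE.
rewrite /rank_in (permP uE).
have: x \in iota 1 (maxl s) by rewrite -sE.
rewrite mem_iota add1n ltnS => /andP[x_gt0 x_le].
rewrite -(subnKC x_le) iotaD count_cat.
rewrite (_ : count _ (iota 1 x) = x); last first.
  rewrite -[RHS](size_iota 1); apply/eqP; rewrite -all_count.
  by apply/allP => y; rewrite mem_iota add1n ltnS => /andP[].
rewrite (_ : count _ _ = 0) ?addn0 //.
apply/eqP; rewrite -leqn0 leqNgt -has_count; apply/hasPn => y.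
by rewrite mem_iota add1n => /andP[xy _]; rewrite -ltnNge.
Qed.

(** The disjoint union of all the sets [Surj_n]. *)
Record pword := PWord { pword_seq :> seq nat; _ : packed pword_seq }.
HB.instance Definition _ := [isSub for pword_seq].
HB.instance Definition _ := [Choice of pword by <:].

Lemma pwordP (w : pword) : packed w. Proof. exact: valP. Qed.

Definition pword_pack (s : seq nat) : pword := PWord (pack_packed s).

Lemma pword_packE s : packed s -> val (pword_pack s) = s.
Proof. exact: pack_id. Qed.

Lemma maxl_packed s : packed s -> (maxl s <= size s)%N.
Proof.
move=> /packedP sE; rewrite -[leqLHS](size_iota 1).
by apply: uniq_leq_size (iota_uniq _ _) _ => x; rewrite sE.
Qed.

(** [Surj_n], listed without repetition (see [mem_surj] and [surj_uniq]):
    the letters of a packed word of length [n] are at most [n]. *)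
Definition surj (n : nat) : seq pword :=
  pmap insub [seq map (@nat_of_ord _) (tval t) | t : n.-tuple 'I_n.+1].

Lemma mem_surj n w : (w \in surj n) = (size w == n).
Proof.
rewrite mem_pmap_sub; apply/imageP/eqP => [[t _ ->]|size_w].
  by rewrite size_map size_tuple.
have w_lt x : x \in val w -> (x < n.+1)%N.
  move=> xw; rewrite ltnS -size_w; apply: leq_trans (maxl_packed (pwordP w)).
  exact: leq_maxl.
have size_t : size [seq inord x : 'I_n.+1 | x <- w] == n by rewrite size_map size_w.
exists (Tuple size_t) => //=; rewrite -map_comp -[LHS]map_id.
by apply/eq_in_map => x /w_lt xn /=; rewrite inordK.
Qed.

Lemma surj_uniq n : uniq (surj n).
Proof.
apply: pmap_sub_uniq; rewrite map_inj_uniq ?enum_uniq //.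
by move=> t u /inj_map/val_inj; apply; apply: val_inj.
Qed.

Fixpoint shuffles (s t : seq nat) : seq (seq nat) :=
  match s with
  | [::] => [:: t]
  | a :: s' =>
    (fix shuffles_s t := match t with
     | [::] => [:: s]
     | b :: t' => map (cons a) (shuffles s' t) ++ map (cons b) (shuffles_s t')
     end) t
  end.

Definition shifted_shuffles (s t : seq nat) : seq (seq nat) :=
  shuffles s (map (addn^~ (maxl s)) t).

Lemma shuffles_perm s t u : u \in shuffles s t -> perm_eq u (s ++ t).
Proof.
elim: s t u => [|a s IHs] t u; first by rewrite inE => /eqP->.
elim: t u => [|b t IHt] u; first by rewrite inE cats0 => /eqP->.
rewrite mem_cat => /orP[] /mapP[v v_in ->].
  by rewrite perm_cons IHs.
by rewrite -[_ ++ _]/((a :: s) ++ [:: b] ++ t) perm_sym perm_catCA perm_cons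
  perm_sym IHt.
Qed.

Lemma maxl_cat s t : maxl (s ++ t) = maxn (maxl s) (maxl t).
Proof. exact: big_cat. Qed.

Lemma packed_shift s t :
  packed s -> packed t -> packed (s ++ map (addn^~ (maxl s)) t).
Proof.
move=> /packedP sE /packedP tE; set t' := map _ t.
have t'E x : (x \in t') = (maxl s < x <= maxl s + maxl t)%N.
  apply/mapP/idP => [[y]|/andP[sx xt]].
    by rewrite tE mem_iota add1n ltnS => /andP[y_gt0 y_le] ->; rewrite addnC
      -[ltnLHS]addn0 ltn_add2l y_gt0 leq_add2l.
  exists (x - maxl s)%N; last by rewrite subnK // ltnW.
  by rewrite tE mem_iota subn_gt0 sx add1n ltnS leq_subLR.
apply/andP; split; apply/allP => x.
  rewrite mem_cat sE mem_iota t'E => /orP[/andP[]//|/andP[sx _]].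
  exact: leq_ltn_trans sx.
rewrite mem_iota add1n ltnS /= mem_cat sE mem_iota t'E add1n ltnS.
case/andP=> -> /=; case: leqP => //= sx xle; apply: leq_trans xle _.
rewrite maxl_cat geq_max leq_addr; apply/bigmax_leqP_seq => y.
by rewrite t'E => /andP[].
Qed.

Lemma shifted_shuffles_packed (s t : pword) u :
  u \in shifted_shuffles s t -> packed u.
Proof.
move/shuffles_perm/perm_mem/eq_packed->.
exact: packed_shift (pwordP _) (pwordP _).
Qed.

(** * Preordered forests *)

Section Forest.
Variable V : finType.
Implicit Types (par : {ffun V -> option V}) (lab : {ffun V -> nat}).

(** [par v] is the parent of [v], [None] for a root, so that edges are
    oriented towards the roots. *)
Definition parent_edge par : rel V := [rel v w | par v == Some w].

(** Such a graph is a forest if and only if it has no cycle, that is if and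
    only if one reaches a root from every vertex. *)
Definition is_forest par : bool :=
  [forall v, exists r, (par r == None) && connect (parent_edge par) v r].

Record pforest := PForest {
  pforest_val : {ffun V -> option V} * {ffun V -> nat};
  _ : is_forest pforest_val.1 && packed (codom pforest_val.2) }.
HB.instance Definition _ := [isSub for pforest_val].
HB.instance Definition _ := [Choice of pforest by <:].

Definition parent (F : pforest) : {ffun V -> option V} := (pforest_val F).1.
Definition label (F : pforest) : {ffun V -> nat} := (pforest_val F).2.

(** [v ->> w] *)
Definition above (F : pforest) : rel V := connect (parent_edge (parent F)).

Lemma pforest_forest F : is_forest (parent F). Proof. by case/andP: (valP F). Qed.
Lemma pforest_packed F : packed (codom (label F)). Proof. by case/andP: (valP F). Qed.

Definition max_label (F : pforest) : nat := maxl (codom (label F)).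

Lemma MkPForest_subproof par lab :
  is_forest par -> packed (codom lab) -> is_forest par && packed (codom lab).
Proof. by move=> -> ->. Qed.
Definition mkPForest par lab (parP : is_forest par) (labP : packed (codom lab)) :=
  @PForest (par, lab) (MkPForest_subproof parP labP).

End Forest.

Definition bijectiveb (V W : finType) (f : {ffun V -> W}) : bool :=
  injectiveb f && [forall w, w \in codom f].

Lemma bijectivebP (V W : finType) (f : {ffun V -> W}) :
  reflect (bijective f) (bijectiveb f).
Proof.
apply: (iffP andP) => [[/injectiveP f_inj /forallP f_surj]|f_bij].
  apply: (inj_card_bij f_inj); rewrite -(card_codom f_inj).
  by apply: subset_leq_card; apply/subsetP => w _; apply: f_surj.
split; first by apply/injectiveP; apply: bij_inj.
by case: f_bij => g fK gK; apply/forallP => w; rewrite -(gK w) codom_f.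
Qed.

Definition forest_iso (V W : finType) (F : pforest V) (G : pforest W) : bool :=
  [exists f : {ffun V -> W}, [&& bijectiveb f,
     [forall v, parent G (f v) == omap f (parent F v)] &
     [forall v, label G (f v) == label F v]]].

Lemma forest_isoP (V W : finType) (F : pforest V) (G : pforest W) :
  reflect (exists2 f : V -> W, bijective f &
             (forall v, parent G (f v) = omap f (parent F v)) /\
             (forall v, label G (f v) = label F v))
          (forest_iso F G).
Proof.
apply: (iffP existsP) => [[f /and3P[/bijectivebP f_bij fP fL]]|[f f_bij [fP fL]]].
  exists f => //; split=> v; apply/eqP; [exact: (forallP fP)|exact: (forallP fL)].
exists (finfun f); apply/and3P; split.
- by apply/bijectivebP; apply: (eq_bij f_bij) => v; rewrite ffunE.
- apply/forallP => v; rewrite ffunE fP; apply/eqP.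
  by apply: eq_omap => u; rewrite ffunE.
- by apply/forallP => v; rewrite ffunE fL.
Qed.

Lemma forest_iso_refl (V : finType) (F : pforest V) : forest_iso F F.
Proof.
apply/forest_isoP; exists id; first by exists id.
by split=> // v; case: (parent F v).
Qed.

Lemma forest_iso_sym (V W : finType) (F : pforest V) (G : pforest W) :
  forest_iso F G -> forest_iso G F.
Proof.
case/forest_isoP => f [g fK gK] [fP fL]; apply/forest_isoP.
exists g; first by exists f.
split=> w; rewrite -{2}(gK w) ?fP ?fL //.
by case: (parent F (g w)) => //= v; rewrite fK.
Qed.

Lemma forest_iso_trans (V W U : finType) (F : pforest V) (G : pforest W)
    (H : pforest U) :
  forest_iso F G -> forest_iso G H -> forest_iso F H.
Proof.
case/forest_isoP => f f_bij [fP fL] /forest_isoP[g g_bij [gP gL]].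
apply/forest_isoP; exists (g \o f); first exact: bij_comp.
split=> v /=; rewrite ?gP ?gL ?fP ?fL //.
by case: (parent F v).
Qed.

(** Isomorphism classes of preordered forests: every forest is isomorphic to
    one whose set of vertices is some ['I_n]. *)
Definition ord_forest := {n : nat & pforest 'I_n}.

Definition ord_forest_iso (F G : ord_forest) : bool :=
  forest_iso (tagged F) (tagged G).

Lemma ord_forest_iso_sym : symmetric ord_forest_iso.
Proof. by move=> F G; apply/idP/idP; apply: forest_iso_sym. Qed.

Lemma ord_forest_iso_trans : transitive ord_forest_iso.
Proof. by move=> G F H; apply: forest_iso_trans. Qed.

Canonical ord_forest_iso_equiv := EquivRel ord_forest_iso
  (fun F => forest_iso_refl (tagged F)) ord_forest_iso_sym ord_forest_iso_trans.

Definition forest_class := {eq_quot ord_forest_iso_equiv}%qT.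
HB.instance Definition _ := Choice.on forest_class.
HB.instance Definition _ := EqQuotient.on forest_class.

(** The number of vertices of a class, and one of its members. *)
Definition nvert (F : forest_class) : nat := tag (repr F).
Definition rep (F : forest_class) : pforest 'I_(nvert F) := tagged (repr F).

Section Relabel.
Variables (V W : finType) (f : V -> W) (g : W -> V).
Hypotheses (fK : cancel f g) (gK : cancel g f).
Variable F : pforest V.

Let par : {ffun W -> option W} := [ffun w => omap f (parent F (g w))].
Let lab : {ffun W -> nat} := [ffun w => label F (g w)].

Lemma relabel_forest : is_forest par.
Proof.
apply/forallP => w; have /forallP/(_ (g w))/existsP[r /andP[/eqP rN]] := pforest_forest F.
case/connectP => p; move gw: (g w) => v; have -> : w = f v by rewrite -gw gK.
elim: p v {gw} => [|u p IHp] v /=.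
  by move=> _ <-; apply/existsP; exists (f r); rewrite ffunE fK rN connect0.
case/andP=> /eqP vu up rE; have /existsP[x /andP[xN ux]] := IHp u up rE.
apply/existsP; exists x; rewrite xN (connect_trans _ ux) // connect1 //.
by rewrite /parent_edge /= ffunE fK vu.
Qed.

Lemma relabel_packed : packed (codom lab).
Proof.
rewrite (@eq_packed _ (codom (label F))) ?pforest_packed // => x.
apply/codomP/codomP => [[w]|[v]] ->; first by exists (g w); rewrite ffunE.
by exists (f v); rewrite ffunE fK.
Qed.

Definition relabel : pforest W := mkPForest relabel_forest relabel_packed.

Lemma relabel_iso : forest_iso F relabel.
Proof.
apply/forest_isoP; exists f; first by exists g.
by split=> v; rewrite ffunE fK.
Qed.

End Relabel.

(** The isomorphism class of a preordered forest on any finite set. *)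
Definition class_of (V : finType) (F : pforest V) : forest_class :=
  \pi%qT (Tagged (fun n => pforest 'I_n) (relabel enum_rankK enum_valK F)).

Lemma rep_class_of (V : finType) (F : pforest V) : forest_iso (rep (class_of F)) F.
Proof.
have : ord_forest_iso (repr (class_of F))
    (Tagged (fun n => pforest 'I_n) (relabel enum_rankK enum_valK F)).
  by rewrite -[ord_forest_iso _ _](eqquotE forest_class) reprK.
by move/forest_iso_trans; apply; apply/forest_iso_sym/relabel_iso.
Qed.

Lemma eq_class_of (V W : finType) (F : pforest V) (G : pforest W) :
  (class_of F == class_of G) = forest_iso F G.
Proof.
rewrite eqquotE; apply/idP/idP => [FG|FG].
  apply: forest_iso_trans (relabel_iso enum_rankK enum_valK F) _.
  by apply: forest_iso_trans FG _; apply/forest_iso_sym/relabel_iso.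
apply: forest_iso_trans (relabel_iso enum_rankK enum_valK G).
by apply: forest_iso_trans FG; apply/forest_iso_sym/relabel_iso.
Qed.

Lemma class_of_rep (F : forest_class) : class_of (rep F) = F.
Proof.
rewrite -[RHS]reprK; apply/eqP; rewrite eqquotE /ord_forest_iso /=.
by apply/forest_iso_sym/(relabel_iso enum_rankK enum_valK).
Qed.

Lemma nvert_class_of (V : finType) (F : pforest V) : nvert (class_of F) = #|V|.
Proof.
by have /forest_isoP[f /bij_eq_card] := rep_class_of F; rewrite card_ord.
Qed.

(** ** Empty forest, disjoint union, induced subforests *)

Lemma empty_forest : @is_forest void [ffun v => None].
Proof. by apply/forallP => -[]. Qed.

Lemma empty_packed : packed (codom ([ffun=> 0%N] : {ffun void -> nat})).
Proof.
rewrite (@eq_packed _ [::]); first by rewrite /packed /maxl big_nil.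
by move=> x; apply/codomP; case=> -[].
Qed.

Definition forest_empty : pforest void := mkPForest empty_forest empty_packed.

Section Union.
Variables (V W : finType) (F : pforest V) (G : pforest W).

Let par : {ffun V + W -> option (V + W)} :=
  [ffun x => match x with
             | inl v => omap inl (parent F v)
             | inr w => omap inr (parent G w)
             end].
Let lab : {ffun V + W -> nat} :=
  [ffun x => match x with
             | inl v => label F v
             | inr w => (label G w + max_label F)%N
             end].

Lemma union_forest : is_forest par.
Proof.
apply/forallP => -[v|w].
- have /forallP/(_ v)/existsP[r /andP[/eqP rN]] := pforest_forest F.
  case/connectP => p; elim: p v => [|u p IHp] v /=.
    by move=> _ <-; apply/existsP; exists (inl r); rewrite ffunE rN connect0.
  case/andP=> /eqP vu up rE; have /existsP[x /andP[xN ux]] := IHp u up rE.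
  apply/existsP; exists x; rewrite xN (connect_trans _ ux) // connect1 //.
  by rewrite /parent_edge /= ffunE vu.
- have /forallP/(_ w)/existsP[r /andP[/eqP rN]] := pforest_forest G.
  case/connectP => p; elim: p w => [|u p IHp] w /=.
    by move=> _ <-; apply/existsP; exists (inr r); rewrite ffunE rN connect0.
  case/andP=> /eqP vu up rE; have /existsP[x /andP[xN ux]] := IHp u up rE.
  apply/existsP; exists x; rewrite xN (connect_trans _ ux) // connect1 //.
  by rewrite /parent_edge /= ffunE vu.
Qed.

Lemma union_packed : packed (codom lab).
Proof.
have /eq_packed-> : codom lab =i
    codom (label F) ++ map (addn^~ (max_label F)) (codom (label G)).
  move=> x; rewrite mem_cat; apply/codomP/orP.
    case=> -[v|w] ->; rewrite ffunE; [left|right]; first exact: codom_f.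
    by apply: map_f; apply: codom_f.
  case=> [/codomP[v ->]|/mapP[_ /codomP[w ->] ->]].
    by exists (inl v); rewrite ffunE.
  by exists (inr w); rewrite ffunE.
by apply: packed_shift; apply: pforest_packed.
Qed.

Definition forest_union : pforest (V + W)%type := mkPForest union_forest union_packed.

End Union.

Section Induced.
Variables (V : finType) (F : pforest V) (A : {set V}).

Let sub_label : seq nat := [seq label F (val x) | x : {v | v \in A}].
Let par : {ffun {v | v \in A} -> option {v | v \in A}} :=
  [ffun x => obind insub (parent F (val x))].
Let lab : {ffun {v | v \in A} -> nat} :=
  [ffun x => rank_in sub_label (label F (val x))].

Lemma induced_forest : is_forest par.
Proof.
apply/forallP => x.
have /forallP/(_ (val x))/existsP[r /andP[/eqP rN]] := pforest_forest F.
case/connectP => p; elim: p x => [|u p IHp] x /=.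
  by move=> _ rE; apply/existsP; exists x; rewrite ffunE -[val x]rE rN connect0.
case/andP=> /eqP xu; case uA: (u \in A); last first.
  move=> _ _; apply/existsP; exists x.
  by rewrite ffunE xu /= insubF // connect0.
move=> up rE; have /existsP[y /andP[yN uy]] := IHp (Sub u uA) up rE.
apply/existsP; exists y; rewrite yN (connect_trans _ uy) // connect1 //.
by rewrite /parent_edge /= ffunE xu /= insubT.
Qed.

Lemma induced_packed : packed (codom lab).
Proof.
rewrite (@eq_packed _ (pack sub_label)) ?pack_packed // => i.
rewrite /pack -map_comp; congr (i \in _).
by apply: eq_codom => x; rewrite ffunE.
Qed.

(** The subforest induced on [A] with the restricted preorder: the labels are
    replaced by their ranks, so as to be again a surjection onto some
    {1, ..., q}. *)
Definition induced : pforest {v | v \in A} := mkPForest induced_forest induced_packed.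

End Induced.

(** ** Admissible cuts *)

Section Cuts.
Variables (V : finType) (F : pforest V).

Definition admissible (c : {set V}) : bool :=
  [forall v in c, forall w in c, above F v w ==> (v == w)].

Definition lea_set (c : {set V}) : {set V} := [set w | [exists v in c, above F w v]].

Definition lea (c : {set V}) := induced F (lea_set c).
Definition roo (c : {set V}) := induced F (~: lea_set c).

End Cuts.

(** The set S^tau_(F,sigma); positions are counted from 0. It is empty if the
    length of [tau] is not the number of vertices of [F]. *)
Definition Sset (V : finType) (F : pforest V) (tau : pword) :
    {set {ffun V -> 'I_(size tau)}} :=
  [set phi : {ffun V -> 'I_(size tau)} | [&& bijectiveb phi,
     [forall v, label F v == nth 0%N tau (phi v)] &
     [forall v', forall v, above F v' v ==> (phi v' <= phi v)%N]]].

(** ** Invariance under isomorphism *)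

Lemma eq_rank_in s t : s =i t -> rank_in s =1 rank_in t.
Proof.
move=> st x; apply/permP/uniq_perm; rewrite ?undup_uniq // => y.
by rewrite !mem_undup.
Qed.

Lemma above_morph (V W : finType) (F : pforest V) (G : pforest W) (f : V -> W) v w :
    (forall u, parent G (f u) = omap f (parent F u)) ->
  above F v w -> above G (f v) (f w).
Proof.
move=> fP /connectP[p]; elim: p v => [|u p IHp] v /=.
  by move=> _ ->; apply: connect0.
case/andP=> /eqP vu up wE; apply: connect_trans (IHp u up wE).
by apply: connect1; rewrite /parent_edge /= fP vu.
Qed.

Section Invariance.
Variables (V W : finType) (F : pforest V) (G : pforest W).
Variables (f : V -> W) (g : W -> V).
Hypotheses (fK : cancel f g) (gK : cancel g f).
Hypothesis fP : forall v, parent G (f v) = omap f (parent F v).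
Hypothesis fL : forall v, label G (f v) = label F v.

Let f_inj : injective f. Proof. exact: can_inj fK. Qed.

Lemma above_iso v w : above G (f v) (f w) = above F v w.
Proof.
apply/idP/idP => [fvw|]; last exact: above_morph.
rewrite -(fK v) -(fK w); apply: above_morph fvw => u.
by rewrite -{2}(gK u) fP; case: (parent F (g u)) => //= x; rewrite fK.
Qed.

Lemma admissible_iso (c : {set V}) : admissible G (f @: c) = admissible F c.
Proof.
apply/forall_inP/forall_inP => [adm v vc|adm _ /imsetP[v vc ->]].
  apply/forall_inP => w wc; rewrite -above_iso -(inj_eq f_inj).
  exact: (forall_inP (adm _ (imset_f f vc)) _ (imset_f f wc)).
apply/forall_inP => _ /imsetP[w wc ->]; rewrite above_iso (inj_eq f_inj).
exact: (forall_inP (adm _ vc) _ wc).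
Qed.

Lemma lea_set_iso (c : {set V}) : lea_set G (f @: c) = f @: lea_set F c.
Proof.
apply/setP => w; rewrite -(gK w) mem_imset // !inE.
apply/exists_inP/exists_inP => [[_ /imsetP[v vc ->]]|[v vc]].
  by rewrite above_iso => wv; exists v.
by move=> wv; exists (f v); rewrite ?imset_f ?above_iso.
Qed.

Lemma induced_iso (A : {set V}) : forest_iso (induced F A) (induced G (f @: A)).
Proof.
pose h (x : {v | v \in A}) : {w | w \in f @: A} := Sub (f (val x)) (imset_f f (valP x)).
have h_inj : injective h.
  by move=> x y /(congr1 val) /= /f_inj xy; apply: val_inj.
have h_bij : bijective h.
  have cardE (U : finType) (C : {set U}) : #|{: {x | x \in C}}| = #|C|.
    by rewrite card_sig; apply: eq_card => x; rewrite inE.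
  by apply: (inj_card_bij h_inj); rewrite !cardE card_imset.
apply/forest_isoP; exists h => //; split=> x; rewrite !ffunE /=.
  rewrite fP; case: (parent F (val x)) => //= u; case uA: (u \in A).
    by rewrite !insubT ?imset_f // => ? /=; congr Some; apply: val_inj.
  by rewrite !insubF //= mem_imset.
rewrite fL; apply: eq_rank_in => i; apply/imageP/imageP => [[y _ ->]|[y _ ->]].
  by case: h_bij => k hK kK; exists (k y) => //; rewrite -{1}(kK y) /= fL.
by exists (h y) => //=; rewrite fL.
Qed.

Lemma Sset_iso_leq tau : (#|Sset F tau| <= #|Sset G tau|)%N.
Proof.
pose h (phi : {ffun V -> 'I_(size tau)}) := [ffun w => phi (g w)].
have h_inj : injective h.
  by move=> phi psi /ffunP hE; apply/ffunP => v; have := hE (f v); rewrite !ffunE fK.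
rewrite -(card_imset _ h_inj); apply: subset_leq_card.
apply/subsetP => psi /imsetP[phi].
rewrite inE => /and3P[/bijectivebP phi_bij /forallP phiL /forallP phiP] ->.
rewrite inE; apply/and3P; split.
- apply/bijectivebP; apply: (@eq_bij _ _ (phi \o g)); last by move=> w; rewrite ffunE.
  by apply: bij_comp => //; exists f.
- by apply/forallP => w; rewrite ffunE -{1}(gK w) fL phiL.
- apply/forallP => w; apply/forallP => w'; rewrite !ffunE -{1}(gK w) -{1}(gK w').
  by rewrite above_iso; apply: (forallP (phiP _)).
Qed.

End Invariance.

Lemma card_Sset_iso (V W : finType) (F : pforest V) (G : pforest W) tau :
  forest_iso F G -> #|Sset F tau| = #|Sset G tau|.
Proof.
move=> FG; apply/eqP; rewrite eqn_leq.
have /forest_isoP[f [g fK gK] [fP fL]] := FG.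
have /forest_isoP[f' [g' fK' gK'] [fP' fL']] := forest_iso_sym FG.
by rewrite (Sset_iso_leq fK gK fP fL) (Sset_iso_leq fK' gK' fP' fL').
Qed.

Lemma max_label_iso (V W : finType) (F : pforest V) (G : pforest W) :
  forest_iso F G -> max_label F = max_label G.
Proof.
case/forest_isoP => f [g fK gK] [fP fL]; apply: eq_maxl => i.
apply/codomP/codomP => [[v ->]|[w ->]]; first by exists (f v); rewrite fL.
by exists (g w); rewrite -fL gK.
Qed.

Lemma union_iso (V V' W W' : finType) (F : pforest V) (F' : pforest V')
    (G : pforest W) (G' : pforest W') :
  forest_iso F F' -> forest_iso G G' ->
  forest_iso (forest_union F G) (forest_union F' G').
Proof.
move=> FF' /forest_isoP[k [k' kK k'K] [kP kL]].
have maxE := max_label_iso FF'.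
case/forest_isoP: FF' => f [f' fK f'K] [fP fL].
apply/forest_isoP; exists (fun x => match x with
  | inl v => inl (f v) | inr w => inr (k w) end).
  exists (fun x => match x with inl v => inl (f' v) | inr w => inr (k' w) end).
    by case=> x; rewrite ?fK ?kK.
  by case=> x; rewrite ?f'K ?k'K.
split=> -[] x; rewrite !ffunE ?fP ?fL ?kP ?kL ?maxE //.
  by case: (parent F x).
by case: (parent G x).
Qed.

(** * Hopf algebras with a distinguished basis *)

Section Linear.
Variables (K : fieldType) (B : choiceType).

(** Linear extension of a map defined on a basis. *)
Definition linext (V : lmodType K) (f : B -> V) (x : {malg K[B]}) : V :=
  \sum_(b <- msupp x) x@_b *: f b.

Lemma linextU (V : lmodType K) (f : B -> V) b : linext f << b >> = f b.
Proof.
by rewrite /linext msuppU oner_eq0 big_seq_fset1 mcoeffUU scale1r.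
Qed.

End Linear.

Section HopfData.
Variables (K : fieldType) (B : choiceType).

(** The structure maps of an algebra and coalgebra with basis [B], given by
    their values on the basis; the tensor square has basis [B * B]. *)
Record hopf_data := HopfData {
  hunit : {malg K[B]};
  hmul_basis : B -> B -> {malg K[B]};
  hcounit_basis : B -> K;
  hcomul_basis : B -> {malg K[(B * B)%type]} }.

Variable H : hopf_data.

Definition hmul (x y : {malg K[B]}) : {malg K[B]} :=
  linext (fun a => linext (hmul_basis H a) y) x.
Definition hcounit (x : {malg K[B]}) : K := linext (hcounit_basis H : B -> K^o) x.
Definition hcomul (x : {malg K[B]}) : {malg K[(B * B)%type]} := linext (hcomul_basis H) x.

(** The product, as a map from the tensor square. *)
Definition hmul_tens (z : {malg K[(B * B)%type]}) : {malg K[B]} :=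
  linext (fun p : B * B => hmul_basis H p.1 p.2) z.

End HopfData.

Section Tensor.
Variable K : fieldType.

Definition tens (B C : choiceType) (x : {malg K[B]}) (y : {malg K[C]}) :
    {malg K[(B * C)%type]} :=
  linext (fun b => linext (fun c => << (b, c) >> : {malg K[(B * C)%type]}) y) x.

(** The tensor product of two linear maps. *)
Definition tens_map (A B C D : choiceType)
    (f : {malg K[A]} -> {malg K[C]}) (g : {malg K[B]} -> {malg K[D]})
    (z : {malg K[(A * B)%type]}) : {malg K[(C * D)%type]} :=
  linext (fun p : A * B => tens (f << p.1 >>) (g << p.2 >>)) z.

Definition is_antipode (B : choiceType) (H : hopf_data K B)
    (S : {linear {malg K[B]} -> {malg K[B]}}) : Prop :=
  forall x, hmul_tens H (tens_map S id (hcomul H x)) = hcounit H x *: hunit H /\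
            hmul_tens H (tens_map id S (hcomul H x)) = hcounit H x *: hunit H.

(** An antipode is unique when it exists, so that the last clause says that
    [f] commutes with the antipodes. *)
Definition is_hopf_morphism (B C : choiceType) (H : hopf_data K B)
    (H' : hopf_data K C) (f : {malg K[B]} -> {malg K[C]}) : Prop :=
  [/\ linear f,
      f (hunit H) = hunit H' /\ (forall x y, f (hmul H x y) = hmul H' (f x) (f y)),
      forall x, hcounit H' (f x) = hcounit H x,
      forall x, hcomul H' (f x) = tens_map f f (hcomul H x) &
      forall S S', is_antipode H S -> is_antipode H' S' ->
        forall x, f (S x) = S' (f x)].

Definition homogeneous (B : choiceType) (deg : B -> nat) (n : nat)
    (x : {malg K[B]}) : Prop :=
  forall b, b \in msupp x -> deg b = n.

Definition homogeneous_map0 (B C : choiceType) (degB : B -> nat) (degC : C -> nat)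
    (f : {malg K[B]} -> {malg K[C]}) : Prop :=
  forall n x, homogeneous degB n x -> homogeneous degC n (f x).

End Tensor.

(** * The Hopf algebras and the map *)

Section Main.
Variable K : fieldType.

(** The values on a class are computed on a representative; the lemmas below
    show that they do not depend on it. *)
Definition Hpo : hopf_data K forest_class := {|
  hunit := << class_of forest_empty >>;
  hmul_basis F G := << class_of (forest_union (rep F) (rep G)) >>;
  hcounit_basis F := (nvert F == 0%N)%:R;
  hcomul_basis F := \sum_(c : {set 'I_(nvert F)} | admissible (rep F) c)
    << (class_of (lea (rep F) c), class_of (roo (rep F) c)) >> |}.

(** [pword_pack] is the identity on the shuffles (see [pword_packE] and
    [shifted_shuffles_packed]). *)
Definition WQSymd : hopf_data K pword := {|
  hunit := << pword_pack [::] >>;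
  hmul_basis s t := \sum_(u <- shifted_shuffles s t) << pword_pack u >>;
  hcounit_basis s := (size s == 0%N)%:R;
  hcomul_basis s := \sum_(i < (size s).+1)
    << (pword_pack (take i s), pword_pack (drop i s)) >> |}.

Definition Phi_basis (F : forest_class) : {malg K[pword]} :=
  \sum_(tau <- surj (nvert F)) << #|Sset (rep F) tau|%:R *g tau >>.

Definition Phi (x : {malg K[forest_class]}) : {malg K[pword]} := linext Phi_basis x.

(** The structure maps and [Phi] can be computed on any preordered forest of
    the class. *)

Lemma Hpo_mulE (V W : finType) (F : pforest V) (G : pforest W) :
  hmul Hpo << class_of F >> << class_of G >> = << class_of (forest_union F G) >>.
Proof.
rewrite /hmul !linextU /=; congr << _ >>; apply/eqP; rewrite eq_class_of.
by apply: union_iso; apply: rep_class_of.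
Qed.

Lemma Hpo_comulE (V : finType) (F : pforest V) :
  hcomul Hpo << class_of F >> = \sum_(c : {set V} | admissible F c)
    << (class_of (lea F c), class_of (roo F c)) >>.
Proof.
rewrite /hcomul linextU /=.
have /forest_isoP[f [g fK gK] [fP fL]] := forest_iso_sym (rep_class_of F).
have f_inj := can_inj fK.
pose imf (c : {set V}) := f @: c.
pose img (d : {set 'I_(nvert (class_of F))}) := g @: d.
have imK : cancel imf img.
  by move=> c; rewrite /img -imset_comp -[RHS]imset_id; apply: eq_imset => x /=; rewrite fK.
have imK' : cancel img imf.
  by move=> d; rewrite /imf -imset_comp -[RHS]imset_id; apply: eq_imset => x /=; rewrite gK.
rewrite (reindex imf) /=; last by apply: onW_bij; exists img.
apply: eq_big => c; first exact: admissible_iso.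
move=> _; congr << _ >>; congr (_, _); apply/eqP; rewrite eq_class_of.
  by apply: forest_iso_sym; rewrite /lea (lea_set_iso fK gK fP); apply: induced_iso.
apply: forest_iso_sym; rewrite /roo (lea_set_iso fK gK fP).
suff -> : ~: (f @: lea_set F c) = f @: (~: lea_set F c).
  exact: (induced_iso fK fP fL).
by apply/setP => w; rewrite -(gK w) in_setC !(mem_imset _ _ f_inj) in_setC.
Qed.

Lemma Phi_classE (V : finType) (F : pforest V) :
  Phi << class_of F >> =
  \sum_(tau <- surj #|V|) << #|Sset F tau|%:R *g tau >> :> {malg K[pword]}.
Proof.
rewrite /Phi linextU /Phi_basis -(nvert_class_of F); apply: eq_bigr => tau _.
by rewrite (card_Sset_iso _ (rep_class_of F)).
Qed.

End Main.

(* Main.v *)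
(* The count of [Sset F tau] over all [tau] is best read word by word: [Phi]
   sends F to the sum, over the orderings s of its vertices in which the
   descendants of a vertex come before it, of the word of labels along s.
   - An ordering of a disjoint union is an interleaving of an ordering of each
     part, and the word of an interleaving is a shuffle of the two words.
   - Cutting an ordering after i letters gives an ideal A of the forest, an
     ordering of A and an ordering of its complement; and the ideals are the
     sets [lea_set F c] for a unique admissible cut c.
   - The antipodes are intertwined by induction on the number of vertices. *)

Require Import Defs.
From mathcomp Require Import all_boot all_algebra.
From mathcomp.multinomials Require Import monalg.
From HB Require Import structures.
From mathcomp Require Import finmap.

Import GRing.Theory.

Local Open Scope ring_scope.

Set Implicit Arguments.
Unset Strict Implicit.
Unset Printing Implicit Defensive.

(** * Linear extensions *)

Section LinearExtension.
Variables (K : fieldType) (B : choiceType) (V : lmodType K).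

(** Coefficients vanish outside the support, so the index set can be enlarged; sums for several
    elements can then share one index set. *)
Lemma linextEw (f : B -> V) (d : {fset B}) (x : {malg K[B]}) :
  (msupp x `<=` d)%fset -> linext f x = \sum_(b <- d) x@_b *: f b.
Proof.
move=> le; rewrite /linext [LHS](big_fset_incl _ le) => //= b _ /mcoeff_outdom ->.
by rewrite scale0r.
Qed.

Lemma linext_is_linear (f : B -> V) : linear (linext f).
Proof.
move=> k x y; pose d := (msupp (k *: x + y) `|` (msupp x `|` msupp y))%fset.
have [dxy dx dy]: [/\ msupp (k *: x + y) `<=` d, msupp x `<=` d & msupp y `<=` d]%fset.
  by split; rewrite ?fsubsetUl // fsubsetU // ?fsubsetUl ?fsubsetUr orbT.
rewrite (linextEw _ dxy) (linextEw _ dx) (linextEw _ dy) scaler_sumr -big_split.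
by apply: eq_bigr => b _ /=; rewrite mcoeffD mcoeffZ scalerDl scalerA.
Qed.

HB.instance Definition _ (f : B -> V) :=
  GRing.isLinear.Build K {malg K[B]} V *:%R (linext f) (linext_is_linear f).

Lemma malgUZ (k : K) (b : B) : << k *g b >> = k *: << b >> :> {malg K[B]}.
Proof. by apply/malgP => c; rewrite mcoeffZ !mcoeffU mulrnAr mulr1. Qed.

Lemma linear_basisE (f : {linear {malg K[B]} -> V}) x :
  f x = \sum_(b <- msupp x) x@_b *: f << b >>.
Proof.
rewrite {1}(monalgE x) raddf_sum; apply: eq_bigr => b _.
by rewrite malgUZ; exact: linearZZ.
Qed.

(** This reduces identities to the basis. The maps are bare functions with proofs of linearity,
    which also covers composites without a canonical linear structure. *)
Lemma malg_linear_eq (f g : {malg K[B]} -> V) :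
  linear f -> linear g -> (forall b, f << b >> = g << b >>) -> f =1 g.
Proof.
move=> f_lin g_lin fg x.
have fE := linear_basisE (HB.pack f (GRing.isLinear.Build K _ V *:%R f f_lin)) x.
have gE := linear_basisE (HB.pack g (GRing.isLinear.Build K _ V *:%R g g_lin)) x.
by rewrite [LHS]fE [RHS]gE; apply: eq_bigr => b _; rewrite /= fg.
Qed.

End LinearExtension.

Lemma linear_fun_sum (K : fieldType) (U V : lmodType K) (f : U -> V) I (r : seq I) (g : I -> U) :
  linear f -> f (\sum_(i <- r) g i) = \sum_(i <- r) f (g i).
Proof.
move=> f_lin; exact: (raddf_sum (HB.pack f (GRing.isLinear.Build K U V *:%R f f_lin)
  : {linear U -> V})).
Qed.

(** * Linearity of the structure maps *)

Section HopfLinear.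
Variables (K : fieldType) (B : choiceType) (H : hopf_data K B).

HB.instance Definition _ := GRing.Linear.copy (hcomul H) (linext (hcomul_basis H)).
HB.instance Definition _ :=
  GRing.Linear.copy (hmul_tens H) (linext (fun p : B * B => hmul_basis H p.1 p.2)).

(** [K^o] is [K] seen as a module over itself. *)
Lemma hcounit_is_linear : linear (hcounit H : _ -> K^o).
Proof. exact: linext_is_linear. Qed.

Lemma hmul_is_linear_l y : linear (hmul H ^~ y).
Proof. exact: linext_is_linear. Qed.

Lemma hmul_is_linear_r x : linear (hmul H x).
Proof.
move=> k y z; rewrite /hmul /linext scaler_sumr -big_split; apply: eq_bigr => b _.
by rewrite [X in _ *: X](linext_is_linear _ k y z) scalerDr !scalerA mulrC.
Qed.

HB.instance Definition _ x :=
  GRing.isLinear.Build K {malg K[B]} {malg K[B]} *:%R (hmul H x) (hmul_is_linear_r x).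

Lemma hmulU a b : hmul H << a >> << b >> = hmul_basis H a b.
Proof. by rewrite /hmul !linextU. Qed.

Lemma hmul_sum I J (r : seq I) (s : seq J) (f : I -> {malg K[B]}) (g : J -> {malg K[B]}) :
  hmul H (\sum_(i <- r) f i) (\sum_(j <- s) g j) =
  \sum_(i <- r) \sum_(j <- s) hmul H (f i) (g j).
Proof.
rewrite (linear_fun_sum _ _ (hmul_is_linear_l _)).
by apply: eq_bigr => i _; rewrite raddf_sum.
Qed.

End HopfLinear.

(** * Tensor products of elements and of linear maps *)

Section TensorLinear.
Variable K : fieldType.

Lemma tens_is_linear_l (B C : choiceType) (y : {malg K[C]}) :
  linear (fun x : {malg K[B]} => tens x y).
Proof. exact: linext_is_linear. Qed.

Lemma tens_is_linear_r (B C : choiceType) (x : {malg K[B]}) :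
  linear (fun y : {malg K[C]} => tens x y).
Proof.
move=> k y z; rewrite /tens /linext scaler_sumr -big_split; apply: eq_bigr => b _.
by rewrite [X in _ *: X](linext_is_linear _ k y z) scalerDr !scalerA mulrC.
Qed.

Lemma tensU (B C : choiceType) (b : B) (c : C) :
  tens << b >> << c >> = << (b, c) >> :> {malg K[(B * C)%type]}.
Proof. by rewrite /tens !linextU. Qed.

HB.instance Definition _ (B C : choiceType) (x : {malg K[B]}) :=
  GRing.isLinear.Build K {malg K[C]} {malg K[(B * C)%type]} *:%R (tens x)
    (tens_is_linear_r x).

Lemma tens_sum (B C : choiceType) I J (r : seq I) (s : seq J)
    (f : I -> {malg K[B]}) (g : J -> {malg K[C]}) :
  tens (\sum_(i <- r) f i) (\sum_(j <- s) g j) =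
  \sum_(i <- r) \sum_(j <- s) tens (f i) (g j).
Proof.
rewrite (linear_fun_sum _ _ (tens_is_linear_l _)).
by apply: eq_bigr => i _; rewrite raddf_sum.
Qed.

HB.instance Definition _ (A B C D : choiceType)
    (f : {malg K[A]} -> {malg K[C]}) (g : {malg K[B]} -> {malg K[D]}) :=
  GRing.Linear.copy (tens_map f g)
    (linext (fun p : A * B => tens (f << p.1 >>) (g << p.2 >>))).

Lemma tens_mapU (A B C D : choiceType)
    (f : {malg K[A]} -> {malg K[C]}) (g : {malg K[B]} -> {malg K[D]}) a b :
  tens_map f g << (a, b) >> = tens (f << a >>) (g << b >>).
Proof. exact: linextU. Qed.

Lemma hmul_tensE (B : choiceType) (H : hopf_data K B) (x y : {malg K[B]}) :
  hmul_tens H (tens x y) = hmul H x y.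
Proof.
move: x; apply: malg_linear_eq => [k u v|k u v|a].
- by rewrite tens_is_linear_l linearP.
- exact: hmul_is_linear_l.
move: y; apply: malg_linear_eq => [k u v|k u v|b].
- by rewrite !linearP.
- by rewrite linearP.
by rewrite tensU hmulU /hmul_tens linextU.
Qed.

End TensorLinear.

HB.instance Definition _ (K : fieldType) :=
  GRing.Linear.copy (@Phi K) (linext (@Phi_basis K)).

(** * Orderings of a forest *)

(** Induction on a path whose end [w] is fixed; the step adds an edge at its start. *)
Lemma connect_ind (V : finType) (e : rel V) (P : V -> Prop) w :
  P w -> (forall v u, e v u -> connect e u w -> P u -> P v) ->
  forall v, connect e v w -> P v.
Proof.
move=> Pw eP v /connectP[p]; elim: p v => [|u p IHp] v /=; first by move=> _ <-.
case/andP=> vu up wE; apply: eP vu _ (IHp u up wE).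
by apply/connectP; exists p.
Qed.

Section Orderings.
Variables (V : finType) (F : pforest V).
Implicit Types (A c : {set V}) (s t : seq V) (v w : V).

Lemma above_refl v : above F v v. Proof. exact: connect0. Qed.

Lemma above_trans : transitive (above F).
Proof. by move=> w v u; apply: connect_trans. Qed.

Lemma above_stepP v w : above F v w ->
  v = w \/ exists2 u, parent F v = Some u & above F u w.
Proof.
case/connectP=> -[|u p] /=; first by move=> _ ->; left.
by case/andP=> /eqP vu up wE; right; exists u => //; apply/connectP; exists p.
Qed.

(** Induction on a path from [v] to a root. If [v] differs from [w], the path from [v] to [w] passes
    through the parent [u] of [v]; then [u] and [v] are above each other, and the induction
    hypothesis identifies them. *)
Lemma above_anti v w : above F v w -> above F w v -> v = w.
Proof.
have /forallP/(_ v)/existsP[r /andP[/eqP rN]] := pforest_forest F.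
move: v => v vr; move: v vr w; apply: connect_ind => [w|v u /eqP vu _ IHu w].
  by case/above_stepP=> [//|[u]]; rewrite rN.
case/above_stepP=> [//|[u']]; rewrite vu => -[<-] uw wv.
have uv : u = v by apply: IHu (above_trans uw wv) (connect1 _); apply/eqP.
by rewrite -uv; apply: IHu; rewrite // uv.
Qed.

(** Being the negation of a reflexive relation, it is irreflexive: a word that is pairwise [before]
    has no repetition. *)
Definition before v w := ~~ above F w v.

(** The words without repetition on [A] in which the descendants of a vertex
    come before it, that is the bijections of [Sset] read as words. *)
Definition orderings A : seq (seq V) :=
  [seq s <- permutations (enum A) | pairwise before s].

Lemma before_uniq s : pairwise before s -> uniq s.
Proof. by apply: pairwise_uniq => v; rewrite /before above_refl. Qed.

Lemma orderings_uniq A : uniq (orderings A).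
Proof. exact/filter_uniq/permutations_uniq. Qed.

Lemma mem_orderings A s :
  (s \in orderings A) = pairwise before s && ([set v in s] == A).
Proof.
rewrite mem_filter mem_permutations; case: (boolP (pairwise _ _)) => //= s_bef.
apply/idP/eqP => [/perm_mem sA|<-].
  by apply/setP => v; rewrite inE sA mem_enum.
apply: uniq_perm; rewrite ?(before_uniq s_bef) ?enum_uniq // => v.
by rewrite mem_enum inE.
Qed.

Lemma size_orderings A s : s \in orderings A -> size s = #|A|.
Proof. by rewrite mem_filter mem_permutations cardE => /andP[_ /perm_size]. Qed.

Lemma mem_orderings_setT s v : s \in orderings setT -> v \in s.
Proof. by rewrite mem_orderings => /andP[_ /eqP/setP/(_ v)]; rewrite !inE => ->. Qed.

End Orderings.

(** A bijection is read as the word of its inverse, whose i-th letter is the vertex sent to i. This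
    reading is injective, and its image consists of the orderings whose word of labels is [tau]. *)
Lemma card_Sset_orderings (V : finType) (F : pforest V) (tau : pword) :
  #|Sset F tau| = count (fun s => map (label F) s == tau) (orderings F setT).
Proof.
(* [pmap] and [pick] read off the inverse without a default vertex, which an empty [V] could not
   supply. *)
pose word (phi : {ffun V -> 'I_(size tau)}) : seq V :=
  pmap (fun i => [pick v | phi v == i]) (enum 'I_(size tau)).
have wordE (phi : {ffun V -> _}) g : cancel phi g -> cancel g phi ->
    word phi = map g (enum 'I_(size tau)).
  move=> phiK gK; rewrite /word; elim: (enum _) => //= i s ->.
  by case: pickP => [v /eqP <-|/(_ (g i))]; rewrite ?phiK // gK eqxx.
have nth_word (phi : {ffun V -> _}) g v0 (i : 'I_(size tau)) :
    cancel phi g -> cancel g phi -> nth v0 (word phi) i = g i.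
  move=> phiK gK; rewrite (wordE phi g) // (nth_map i) ?nth_ord_enum //.
  by rewrite size_enum_ord.
have word_inj : {in enum (Sset F tau) &, injective word}.
  move=> phi psi; rewrite !mem_enum !inE.
  move=> /andP[/bijectivebP[g phiK gK] _] /andP[/bijectivebP[h psiK hK] _] eq_word.
  apply/ffunP => v; apply: (can_inj hK).
  by rewrite psiK -(nth_word psi h v) // -eq_word (nth_word phi g).
rewrite -size_filter cardE -(size_map word); apply/perm_size/uniq_perm.
- by rewrite map_inj_in_uniq ?enum_uniq.
- exact/filter_uniq/orderings_uniq.
move=> s; rewrite mem_filter mem_orderings; apply/mapP/and3P.
  case=> phi; rewrite mem_enum inE.
  move=> /and3P[/bijectivebP[g phiK gK] /forallP phiL /forallP phiP] ->.
  rewrite (wordE phi g) //; split.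
  - apply/eqP/(@eq_from_nth _ 0%N) => [|i]; rewrite 2!size_map size_enum_ord // => i_lt.
    rewrite -map_comp (nth_map (Ordinal i_lt)) ?size_enum_ord //.
    by rewrite (nth_ord_enum _ (Ordinal i_lt)) /= (eqP (phiL _)) gK.
  (* Letters are listed by increasing position, and a descendant at a later position would
     contradict the monotonicity of [phi]. *)
  - rewrite pairwise_map; have: pairwise ltn (map val (enum 'I_(size tau))).
      by rewrite val_enum_ord -(sorted_pairwise ltn_trans) iota_ltn_sorted.
    rewrite pairwise_map; apply: sub_pairwise => i j /= ij; apply/negP => ji.
    by have := implyP (forallP (phiP _) _) ji; rewrite !gK leqNgt ij.
  - apply/eqP/setP => v; rewrite !inE; apply/mapP; exists (phi v) => //.
    by rewrite mem_enum.
(* Conversely, [s] comes from the map sending each vertex to its position in [s]. *)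
case=> /eqP tauE s_bef /eqP/setP sT.
have s_uniq := before_uniq s_bef.
have sV v : v \in s by have := sT v; rewrite !inE.
have size_s : size tau = size s by rewrite -tauE size_map.
have lt_index v : (index v s < size tau)%N by rewrite size_s index_mem.
pose phi : {ffun V -> 'I_(size tau)} := [ffun v => Ordinal (lt_index v)].
have lt_size (i : 'I_(size tau)) : (i < size s)%N by rewrite -size_s.
pose g i : V := tnth (in_tuple s) (Ordinal (lt_size i)).
have gE v0 i : g i = nth v0 s i by rewrite /g (tnth_nth v0).
have phiK : cancel phi g by move=> v; rewrite (gE v) ffunE /= nth_index.
have gK : cancel g phi.
  by move=> i; apply: val_inj; rewrite ffunE /= (gE (g i)) index_uniq.
exists phi; last first.
  (* Comparison by [nth] needs a default vertex; if there is none, both words are empty. *)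
  rewrite (wordE phi g) //; have [v0 _|noV] := pickP (fun _ : V => true); last first.
    by case: (s) => [|v t]; [case: (map _ _) => // v t|]; have := noV v.
  apply/esym/(@eq_from_nth _ v0) => [|i]; rewrite size_map size_enum_ord // => i_lt.
  rewrite (nth_map (Ordinal i_lt)) ?size_enum_ord //.
  by rewrite (nth_ord_enum _ (Ordinal i_lt)) (gE v0).
rewrite mem_enum inE; apply/and3P; split.
- by apply/bijectivebP; exists g.
- apply/forallP => v; rewrite ffunE /= -tauE (nth_map v) ?index_mem //.
  by rewrite nth_index.
apply/forallP => v; apply/forallP => w; apply/implyP => vw.
rewrite !ffunE /= leqNgt; apply/negP => lt_wv.
have /(pairwiseP v)/(_ _ _ _ _ lt_wv) := s_bef.
by rewrite !inE !index_mem !nth_index // /before vw => /(_ (sV _) (sV _)).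
Qed.

(** An ordering visits every vertex, so its word has the same letters as [label F]; hence
    [pword_pack] leaves it unchanged. *)
Lemma word_packed (V : finType) (F : pforest V) s :
  s \in orderings F setT -> packed (map (label F) s).
Proof.
move=> sT; rewrite (@eq_packed _ (codom (label F))) ?pforest_packed // => x.
apply/mapP/codomP => [[v _ ->]|[v ->]]; first by exists v.
by exists v => //; apply: mem_orderings_setT sT.
Qed.

(** Each cardinal becomes a sum of ones over orderings; after exchanging the sums, an ordering
    contributes only to the [tau] that is its word. *)
Lemma Phi_orderings (K : fieldType) (V : finType) (F : pforest V) :
  Phi << class_of F >> =
  \sum_(s <- orderings F setT) << pword_pack (map (label F) s) >> :> {malg K[pword]}.
Proof.
rewrite Phi_classE; under eq_bigr => tau _.
  rewrite card_Sset_orderings -sum1_count natr_sum raddf_sum /=.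
  over.
rewrite (exchange_big_dep (fun s => true)) //= big_seq [RHS]big_seq.
apply: eq_bigr => s sT; rewrite (big_rem (pword_pack (map (label F) s))) /=; last first.
  by rewrite mem_surj /= size_map size_map (size_orderings sT) cardsT.
rewrite pack_id ?word_packed // eqxx big1_seq ?addr0 // => tau /andP[/eqP tauE].
rewrite mem_rem_uniq ?surj_uniq // inE => /andP[/eqP[]].
by apply: val_inj; rewrite /= -tauE pack_id ?word_packed.
Qed.

(** * Product *)

Section Interleavings.
Variables A B : eqType.
Implicit Types (s : seq A) (t : seq B) (u : seq (A + B)).

(** The recursion of [shuffles], on letters that remember their side. Interleavings are distinct
    even when the shuffles they yield coincide, so multiplicities are kept. *)
Fixpoint interleavings s t : seq (seq (A + B)) :=
  match s with
  | [::] => [:: map inr t]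
  | a :: s' =>
    (fix interleavings_s t := match t with
     | [::] => [:: map inl s]
     | b :: t' => map (cons (inl a)) (interleavings s' t) ++
                  map (cons (inr b)) (interleavings_s t')
     end) t
  end.

Definition lefts u : seq A := pmap (fun x => if x is inl a then Some a else None) u.
Definition rights u : seq B := pmap (fun x => if x is inr b then Some b else None) u.

Lemma lefts_inl s : lefts (map inl s) = s.
Proof. by elim: s => //= a s ->. Qed.

Lemma rights_inl s : rights (map inl s) = [::].
Proof. by elim: s. Qed.

Lemma lefts_inr t : lefts (map inr t) = [::].
Proof. by elim: t. Qed.

Lemma rights_inr t : rights (map inr t) = t.
Proof. by elim: t => //= b t ->. Qed.

Lemma mem_lefts u a : (a \in lefts u) = (inl a \in u).
Proof. by elim: u => //= -[a'|b] u IHu; rewrite !inE IHu. Qed.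

Lemma mem_rights u b : (b \in rights u) = (inr b \in u).
Proof. by elim: u => //= -[a|b'] u IHu; rewrite !inE IHu. Qed.

(** The tag of the first letter of [u] tells which branch of the recursion can have produced it;
    removing it leaves the same question for shorter words. *)
Lemma mem_interleavings s t u :
  (u \in interleavings s t) = (lefts u == s) && (rights u == t).
Proof.
elim: s t u => [|a s IHs] t u.
  rewrite inE; apply/eqP/andP => [->|[]]; first by rewrite lefts_inr rights_inr.
  by elim: u t => [|[a|b] u IHu] [|b' t] //= /IHu{}IHu /eqP[<- /eqP/IHu ->].
elim: t u => [|b t IHt] u.
  rewrite inE; apply/eqP/andP => [->|[+ +]]; first by rewrite lefts_inl rights_inl.
  by elim: u (a :: s) => [|[a'|b] u IHu] [|a0 s0] //= /eqP[<- /eqP/IHu{}IHu] /IHu ->.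
have map_cons x r (y : A + B) rs : (x :: r \in map (cons y) rs) = (x == y) && (r \in rs).
  by apply/mapP/andP => [[r' ? [-> ->]]|[/eqP-> ?]]; [rewrite eqxx | exists r].
rewrite mem_cat; case: u => [|x u].
  by apply/orP => -[] /mapP[].
rewrite !map_cons IHs IHt; case: x => [a1|b1].
  rewrite -[lefts (_ :: _)]/(a1 :: lefts u) -[rights (_ :: _)]/(rights u).
  by rewrite eqseq_cons orbF andbA.
rewrite -[lefts (_ :: _)]/(lefts u) -[rights (_ :: _)]/(b1 :: rights u).
by rewrite eqseq_cons [RHS]andbCA.
Qed.

Lemma interleavings_uniq s t : uniq (interleavings s t).
Proof.
elim: s t => [//|a s IHs]; elim=> [//|b t IHt].
rewrite /= cat_uniq !map_inj_uniq ?IHs ?IHt; try by move=> u v [].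
by rewrite andbT /=; apply/hasPn => _ /mapP[u _ ->]; apply/mapP => -[].
Qed.

(** Both recursions branch alike, so the lists are equal, multiplicities included. *)
Lemma shuffles_interleavings (f : A -> nat) (g : B -> nat) s t :
  shuffles (map f s) (map g t) =
  [seq map (fun x => match x with inl a => f a | inr b => g b end) u
     | u <- interleavings s t].
Proof.
elim: s t => [|a s IHs] t; first by rewrite /= -map_comp.
elim: t => [|b t IHt]; first by rewrite /= -map_comp.
(* The nested fixpoints are unfolded once by conversion, keeping the recursive calls folded. *)
rewrite -[LHS]/(map (cons (f a)) (shuffles (map f s) (map g (b :: t))) ++
  map (cons (g b)) (shuffles (map f (a :: s)) (map g t))).
rewrite -[interleavings _ _]/(map (cons (inl a)) (interleavings s (b :: t)) ++
  map (cons (inr b)) (interleavings (a :: s) t)).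
by rewrite IHs IHt map_cat -!map_comp.
Qed.

End Interleavings.

(** * Orderings of a disjoint union *)

Section Union.
Variables (V W : finType) (F : pforest V) (G : pforest W).
Let U := forest_union F G.

(** Parents stay in the same part, so no path crosses from one part to the other. *)
Lemma above_unionE (x y : V + W) : above U x y =
  match x, y with
  | inl v, inl v' => above F v v'
  | inr w, inr w' => above G w w'
  | _, _ => false
  end.
Proof.
apply/idP/idP; last first.
  case: x y => [v|w] [v'|w'] //; apply: above_morph => z; by rewrite ffunE.
move: x; apply: connect_ind => [|x z xz _]; first by case: y => v; apply: above_refl.
move: xz; rewrite /parent_edge /= ffunE.
case: x => [v|w].
  case vv': (parent F v) => [v'|//] /eqP[<-] /=; case: y => // y.
  by apply: connect_trans; apply: connect1; apply/eqP.
case ww': (parent G w) => [w'|//] /eqP[<-] /=; case: y => // y.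
by apply: connect_trans; apply: connect1; apply/eqP.
Qed.

Lemma pairwise_before_union (u : seq (V + W)) :
  pairwise (before U) u = pairwise (before F) (lefts u) && pairwise (before G) (rights u).
Proof.
elim: u => //= x u ->.
have -> : all (before U x) u =
    match x with inl v => all (before F v) (lefts u) | inr w => all (before G w) (rights u) end.
  elim: u => [|y u IHu] /=; first by case: x.
  by rewrite IHu /before above_unionE; case: x y {IHu} => [v|w] [v'|w'].
by case: x => [v|w] /=; rewrite -?andbA // andbCA.
Qed.

Lemma mem_orderings_union (u : seq (V + W)) :
  (u \in orderings U setT) =
  (lefts u \in orderings F setT) && (rights u \in orderings G setT).
Proof.
rewrite !mem_orderings pairwise_before_union.
have -> : ([set x in u] == setT) = ([set v in lefts u] == setT) && ([set w in rights u] == setT).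
  apply/eqP/andP => [/setP uT|[/eqP/setP lT /eqP/setP rT]].
    split; apply/eqP/setP => z; rewrite !inE ?mem_lefts ?mem_rights.
      by have := uT (inl z); rewrite !inE.
    by have := uT (inr z); rewrite !inE.
  apply/setP => -[z|z]; rewrite !inE -?mem_lefts -?mem_rights.
    by have := lT z; rewrite !inE.
  by have := rT z; rewrite !inE.
by rewrite -!andbA; congr andb; rewrite andbCA.
Qed.

(** An ordering [u] of the union interleaves exactly one pair of orderings, [lefts u] and
    [rights u]. *)
Lemma big_orderings_union (M : zmodType) (h : seq (V + W) -> M) :
  \sum_(u <- orderings U setT) h u =
  \sum_(s <- orderings F setT) \sum_(t <- orderings G setT)
    \sum_(u <- interleavings s t) h u.
Proof.
(* Sums with a single term are inserted, then exchanged with the sum over [u]. *)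
transitivity (\sum_(u <- orderings U setT)
    \sum_(s <- orderings F setT | s == lefts u)
      \sum_(t <- orderings G setT | t == rights u) h u).
  rewrite big_seq [RHS]big_seq; apply: eq_bigr => u.
  rewrite mem_orderings_union => /andP[uF uG].
  rewrite -big_filter filter_pred1_uniq ?orderings_uniq // big_seq1.
  by rewrite -big_filter filter_pred1_uniq ?orderings_uniq // big_seq1.
rewrite (exchange_big_dep xpredT) //= big_seq [RHS]big_seq; apply: eq_bigr => s sF.
rewrite (exchange_big_dep xpredT) //= big_seq [RHS]big_seq; apply: eq_bigr => t tG.
rewrite -big_filter; apply/perm_big/uniq_perm.
- exact/filter_uniq/orderings_uniq.
- exact: interleavings_uniq.
move=> u; rewrite mem_filter mem_interleavings mem_orderings_union.
rewrite (eq_sym s) (eq_sym t).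
by case: eqP => // ->; case: eqP => //= ->; rewrite sF tG.
Qed.

End Union.

Lemma Phi_mul (K : fieldType) (x y : {malg K[forest_class]}) :
  Phi (hmul (Hpo K) x y) = hmul (WQSymd K) (Phi x) (Phi y).
Proof.
move: x; apply: malg_linear_eq => [k u v|k u v|F].
- by rewrite hmul_is_linear_l; exact: linearP.
- by rewrite -hmul_is_linear_l; congr (hmul _ _ _); exact: linearP.
move: y; apply: malg_linear_eq => [k u v|k u v|G].
- by rewrite hmul_is_linear_r; exact: linearP.
- by rewrite -hmul_is_linear_r; congr (hmul _ _ _); exact: linearP.
rewrite -(class_of_rep F) -(class_of_rep G) Hpo_mulE.
apply: etrans (Phi_orderings K (forest_union (rep F) (rep G))) _.
apply/esym/(etrans (f_equal2 _ (Phi_orderings K (rep F)) (Phi_orderings K (rep G)))).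
apply/esym; rewrite big_orderings_union.
rewrite hmul_sum big_seq [RHS]big_seq; apply: eq_bigr => s sF.
rewrite big_seq [RHS]big_seq; apply: eq_bigr => t tG.
rewrite hmulU /= !pack_id ?word_packed //.
rewrite /shifted_shuffles -[map _ (map _ t)]map_comp.
(* The shuffle product shifts by the maximum of the word, the union by the maximal label; they agree
   since [s] visits every vertex. *)
have -> : maxl (map (label (rep F)) s) = max_label (rep F).
  apply: eq_maxl => x; apply/mapP/codomP => [[v _ ->]|[v ->]]; first by exists v.
  by exists v => //; apply: mem_orderings_setT sF.
rewrite shuffles_interleavings big_map; apply: eq_bigr => u _.
congr << pword_pack _ >>; apply: eq_map => -[v|w]; by rewrite ffunE.
Qed.
(** * Coproduct *)

Section Ideals.
Variables (V : finType) (F : pforest V).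
Implicit Types (A c : {set V}) (s t : seq V) (v w : V).

(** Ideals will index the terms of the coproduct in place of admissible cuts. *)
Definition ideal A := [forall v in A, forall w, above F w v ==> (w \in A)].

Lemma idealP A : reflect (forall v w, v \in A -> above F w v -> w \in A) (ideal A).
Proof.
apply: (iffP forall_inP) => [idA v w vA wv|idA v vA].
  exact: (implyP (forallP (idA v vA) w) wv).
by apply/forallP => w; apply/implyP; apply: idA.
Qed.

(** For an ideal, this is the admissible cut that detaches it. *)
Definition tops A := [set v in A | [forall w in A, above F v w ==> (v == w)]].

Lemma topsP A v :
  reflect (v \in A /\ forall w, w \in A -> above F v w -> v = w) (v \in tops A).
Proof.
rewrite inE; apply: (iffP andP) => -[vA v_top]; split=> //.
  by move=> w wA vw; apply/eqP/(implyP (forall_inP v_top w wA)).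
by apply/forall_inP => w wA; apply/implyP => vw; apply/eqP/v_top.
Qed.

(** Among the ancestors of [v] in [A], one with the most descendants is a top: a strict ancestor
    would have the same descendants and itself in addition. *)
Lemma exists_top A v : v \in A -> exists2 w, w \in tops A & above F v w.
Proof.
move=> vA; pose height w := #|[set u | above F u w]|.
pose P w := (w \in A) && above F v w.
have Pv : P v by rewrite /P vA above_refl.
case: (@arg_maxnP _ v P height Pv) => w /andP[wA vw] w_max.
exists w => //; apply/topsP; split=> // x xA wx.
apply/eqP/negPn/negP => neq_wx.
have := w_max x; rewrite /P xA (above_trans vw wx) => /(_ isT).
apply/negP; rewrite -ltnNge; apply/proper_card/properP; split.
  by apply/subsetP => u; rewrite !inE => /above_trans; apply.
exists x; rewrite !inE ?above_refl //; apply/negP => xw.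
by rewrite (above_anti wx xw) eqxx in neq_wx.
Qed.

Lemma lea_set_ideal c : ideal (lea_set F c).
Proof.
apply/idealP => v w; rewrite !inE => /exists_inP[u uc vu] wv.
by apply/exists_inP; exists u => //; apply: above_trans vu.
Qed.

Lemma lea_set_tops A : ideal A -> lea_set F (tops A) = A.
Proof.
move=> /idealP idA; apply/setP => v; rewrite inE.
apply/exists_inP/idP => [[w /topsP[wA _]]|/exists_top[w]]; first exact: idA.
by exists w.
Qed.

(** With [lea_set_tops], this makes [lea_set] and [tops] inverse bijections between admissible cuts
    and ideals. The form is the condition produced by [reindex_onto]. *)
Lemma admissible_tops c : admissible F c = (tops (lea_set F c) == c).
Proof.
apply/idP/eqP => [/forall_inP adm|<-].
  have lea_c v : v \in c -> v \in lea_set F c.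
    by move=> vc; rewrite inE; apply/exists_inP; exists v; rewrite ?above_refl.
  apply/setP => v; apply/topsP/idP => [[]|vc].
    by rewrite inE => /exists_inP[w wc vw] /(_ w (lea_c w wc) vw) ->.
  split=> [|w]; first exact: lea_c.
  rewrite inE => /exists_inP[u uc wu] vw.
  have /eqP vu := implyP (forall_inP (adm v vc) u uc) (above_trans vw wu).
  by apply: (above_anti vw); rewrite vu.
apply/forall_inP => v /topsP[_ v_top]; apply/forall_inP => w /topsP[wA _].
by apply/implyP => vw; apply/eqP/v_top.
Qed.

Lemma Hpo_comul_ideals (K : fieldType) :
  hcomul (Hpo K) << class_of F >> = \sum_(A : {set V} | ideal A)
    << (class_of (induced F A), class_of (induced F (~: A))) >>.
Proof.
rewrite Hpo_comulE [RHS](reindex_onto (lea_set F) tops) /=; last first.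
  by move=> A; apply: lea_set_tops.
by apply: eq_bigl => c; rewrite lea_set_ideal admissible_tops.
Qed.

(** [induced] makes a root of any vertex whose parent is outside [A]. Convexity keeps paths between
    vertices of [A] inside [A], so that no relation is lost. *)
Definition convex A :=
  forall v u w, v \in A -> w \in A -> above F v u -> above F u w -> u \in A.

Lemma ideal_convex A : ideal A -> convex A.
Proof. by move=> /idealP idA v u w _ wA _; apply: idA. Qed.

Lemma idealC_convex A : ideal A -> convex (~: A).
Proof.
by move=> /idealP idA v u w; rewrite !inE => vA _ vu _; apply: contra vA => /idA; apply.
Qed.

(** * Forests induced on convex sets *)

Section Convex.
Variable A : {set V}.
Hypothesis convA : convex A.

Lemma above_induced (x y : {v | v \in A}) :
  above (induced F A) x y = above F (val x) (val y).
Proof.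
apply/idP/idP.
  move: x; apply: connect_ind => [|x z /eqP]; first exact: above_refl.
  rewrite ffunE; case xu: (parent F (val x)) => [u|] //=.
  case: insubP => // z' _ z'u [z'z] _; rewrite -z'z z'u.
  by apply: connect_trans; apply: connect1; apply/eqP.
move xv: (val x) => v vy; move: v vy x xv; apply: connect_ind => [x xy|v u /eqP vu uy IHu x xv].
  by rewrite (val_inj xy) above_refl.
(* [u] lies on the path from [val x] to [val y]. *)
have uA : u \in A.
  apply: (@convA (val x) _ (val y)); rewrite ?(valP x) ?(valP y) //.
  by rewrite xv; apply: connect1; apply/eqP.
apply: connect_trans (IHu (Sub u uA) _); last by rewrite SubK.
by apply: connect1; rewrite /parent_edge /= ffunE xv vu /= insubT.
Qed.

Lemma orderings_induced :
  perm_eq (map (map val) (orderings (induced F A) setT)) (orderings F A).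
Proof.
apply: uniq_perm; rewrite ?orderings_uniq //.
  by rewrite map_inj_uniq ?orderings_uniq //; apply/inj_map/val_inj.
have bef_val (t : seq {v | v \in A}) :
    pairwise (before F) (map val t) = pairwise (before (induced F A)) t.
  by rewrite pairwise_map; apply: eq_pairwise => x y; rewrite /before above_induced.
move=> s; rewrite mem_orderings; apply/mapP/andP => [[t + ->]|[s_bef /eqP sA]].
  rewrite mem_orderings => /andP[t_bef /eqP/setP tT]; split; first by rewrite bef_val.
  apply/eqP/setP => v; rewrite inE; apply/mapP/idP => [[x _ ->]|vA]; first exact: valP.
  by exists (Sub v vA); rewrite ?SubK //; have := tT (Sub v vA); rewrite !inE.
pose t : seq {v | v \in A} := pmap insub s.
have tE : map val t = s.
  rewrite (pmap_filter (insubK _)); apply/all_filterP/allP => v vs.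
  by rewrite /= isSome_insub -sA inE.
exists t => //; rewrite mem_orderings -bef_val tE s_bef; apply/eqP/setP => x.
rewrite !inE -(mem_map val_inj) tE; have /setP/(_ (val x)) := sA.
by rewrite inE => ->; apply: valP.
Qed.

(** Since [t] visits all of [A], the ranks that label the induced forest are the ranks in the word
    of original labels; packing twice is packing once. *)
Lemma pack_label_induced (t : seq {v | v \in A}) : t \in orderings (induced F A) setT ->
  pword_pack (map (label (induced F A)) t) = pword_pack (map (label F) (map val t)).
Proof.
move=> tT; apply: val_inj; rewrite /= -(pack_id (pack_packed (map (label F) _))).
congr pack; rewrite /pack; set w := map (label F) _; rewrite {2}/w -!map_comp.
apply/eq_map => x; rewrite ffunE /=.
apply: eq_rank_in => i; apply/imageP/mapP => [[y _ ->]|[_ /mapP[y _ ->] ->]].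
  by exists (val y); rewrite ?map_f // (mem_orderings_setT _ tT).
by exists y.
Qed.

Lemma Phi_induced (K : fieldType) :
  Phi << class_of (induced F A) >> =
  \sum_(s <- orderings F A) << pword_pack (map (label F) s) >> :> {malg K[pword]}.
Proof.
apply: etrans (Phi_orderings K _) _; rewrite -(perm_big _ orderings_induced) big_map.
rewrite big_seq [RHS]big_seq; apply: eq_bigr => t tT.
by rewrite pack_label_induced.
Qed.

End Convex.

(** Descendants come first, so the letters before a cut form an ideal; conversely, an ordering of an
    ideal followed by one of its complement is an ordering of the forest. *)
Lemma big_orderings_cut (M : zmodType) (h : seq V -> seq V -> M) :
  \sum_(s <- orderings F setT) \sum_(i < (size s).+1) h (take i s) (drop i s) =
  \sum_(A : {set V} | ideal A)
    \sum_(s <- orderings F A) \sum_(t <- orderings F (~: A)) h s t.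
Proof.
(* Both sides are sums over lists of pairs of words, to be shown free of repetition and with the
   same members. *)
pose cuts := [seq (take i s, drop i s) | s <- orderings F setT, i <- iota 0 (size s).+1].
pose pairs := [seq st | A <- enum ideal,
  st <- [seq (s, t) | s <- orderings F A, t <- orderings F (~: A)]].
transitivity (\sum_(st <- cuts) h st.1 st.2).
  rewrite big_allpairs_dep; apply: eq_bigr => s _.
  by rewrite -(big_mkord xpredT (fun i => h (take i s) (drop i s))) /index_iota subn0.
transitivity (\sum_(st <- pairs) h st.1 st.2); last first.
  rewrite big_allpairs_dep big_enum; apply: eq_bigr => A _.
  by rewrite big_allpairs_dep.
have mem_cuts s t : ((s, t) \in cuts) = (s ++ t \in orderings F setT).
  apply/allpairsPdep/idP => [[u [i [uT _ [-> ->]]]]|stT]; first by rewrite cat_take_drop.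
  exists (s ++ t), (size s); rewrite take_size_cat // drop_size_cat //; split=> //.
  by rewrite mem_iota add0n ltnS size_cat leq_addr.
have mem_pairs s t : ((s, t) \in pairs) =
    [&& ideal [set v in s], s \in orderings F [set v in s]
      & t \in orderings F (~: [set v in s])].
  apply/allpairsPdep/and3P => [[A [_ [idA /allpairsP[[s' t'] /= [sA tA ->]] [-> ->]]]]|].
    rewrite mem_enum in idA; have := sA; rewrite mem_orderings => /andP[_ /eqP->].
    by split.
  case=> idA sA tA; exists [set v in s], (s, t); rewrite mem_enum; split=> //.
  by apply/allpairsP; exists (s, t).
apply/perm_big/uniq_perm.
- apply: allpairs_uniq_dep; first exact: orderings_uniq.
    by move=> s _; apply: iota_uniq.
  (* Concatenation recovers the ordering, and the size of the first word recovers the place of the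
     cut. *)
  move=> _ _ /allpairsPdep[s [i [_ i_le ->]]] /allpairsPdep[t [j [_ j_le ->]]] /= [st1 st2].
  rewrite !mem_iota !add0n !ltnS /= in i_le j_le.
  have st : s = t by rewrite -(cat_take_drop i s) st1 st2 cat_take_drop.
  by rewrite -st in st1 j_le *; rewrite -(size_takel i_le) st1 size_takel.
- apply: allpairs_uniq_dep; first exact: enum_uniq.
    by move=> A _; apply: allpairs_uniq; rewrite ?orderings_uniq // => -[? ?] [? ?] _ _ [-> ->].
  (* The ideal is recovered as the set of letters of the first word. *)
  move=> _ _ /allpairsPdep[A [st [_ + ->]]] /allpairsPdep[B [st' [_ + ->]]] /=.
  move=> + + est; rewrite -est {st' est}.
  case/allpairsP=> -[s t] /= [sA _ ->] /allpairsP[[s' t'] /= [sB _ [ss' _]]].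
  move: sA sB; rewrite -ss' !mem_orderings => /andP[_ /eqP<-] /andP[_ /eqP<-].
  by [].
case=> s t; rewrite mem_cuts mem_pairs !mem_orderings pairwise_cat eqxx andbT.
apply/andP/and3P => [[/and3P[st s_bef t_bef] /eqP/setP stT]|].
  have st_disj v : v \in s -> v \in t -> false.
    by move=> vs vt; have := allrelP st v v vs vt; rewrite /before above_refl.
  have stE v : (v \in s) || (v \in t) by have := stT v; rewrite !inE mem_cat.
  split=> //; last first.
    rewrite t_bef; apply/eqP/setP => v; rewrite !inE.
    by apply/idP/idP => [vt|/negPf vs]; [apply/negP => /st_disj/(_ vt) | have := stE v; rewrite vs].
  (* A descendant [w] of [v] lying in [t] would come after [v]. *)
  apply/idealP => v w; rewrite !inE => vs wv; have /orP[//|wt] := stE w.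
  by have := allrelP st v w vs wt; rewrite /before wv.
case=> /idealP ids s_bef /andP[t_bef /eqP/setP tE]; rewrite s_bef t_bef !andbT; split.
  (* Otherwise [w], a descendant of a letter of [s], would be in the ideal. *)
  apply/allrelP => v w vs wt; apply/negP => wv.
  by have := tE w; have := ids v w; rewrite !inE wt vs => /(_ isT wv) ->.
by apply/eqP/setP => v; have := tE v; rewrite !inE mem_cat => ->; apply: orbN.
Qed.

End Ideals.

(** Both sides become a sum over an ideal, an ordering of it and an ordering of its complement: the
    left by cutting orderings, the right by [Phi_induced]. *)
Lemma Phi_comul (K : fieldType) (x : {malg K[forest_class]}) :
  hcomul (WQSymd K) (Phi x) = tens_map (@Phi K) (@Phi K) (hcomul (Hpo K) x).
Proof.
move: x; apply: malg_linear_eq => [k u v|k u v|F].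
- by rewrite -linearP; congr hcomul; exact: linearP.
- by rewrite -linearP; congr tens_map; exact: linearP.
rewrite -(class_of_rep F) Hpo_comul_ideals.
transitivity (\sum_(A : {set 'I_(nvert F)} | ideal (rep F) A)
    tens (Phi << class_of (induced (rep F) A) >>)
      (Phi << class_of (induced (rep F) (~: A)) >>) : {malg K[(pword * pword)%type]});
  last first.
  apply/esym/(etrans (raddf_sum _ _ _ _)); apply: eq_bigr => A _; exact: tens_mapU.
pose word s := pword_pack (map (label (rep F)) s).
transitivity (\sum_(A : {set 'I_(nvert F)} | ideal (rep F) A)
    \sum_(s <- orderings (rep F) A) \sum_(t <- orderings (rep F) (~: A))
      << (word s, word t) >> : {malg K[(pword * pword)%type]}); last first.
  apply: eq_bigr => A idA.
  apply/esym/(etrans (f_equal2 (@tens K _ _) (Phi_induced (ideal_convex idA) K)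
    (Phi_induced (idealC_convex idA) K))); rewrite tens_sum.
  by apply: eq_bigr => s _; apply: eq_bigr => t _; rewrite tensU.
rewrite -(big_orderings_cut (rep F) (fun s t => << (word s, word t) >>)).
apply: etrans (congr1 _ (Phi_orderings K (rep F))) _.
rewrite raddf_sum big_seq [RHS]big_seq; apply: eq_bigr => s sT.
apply: etrans (linextU _ _) _; rewrite /= pack_id ?word_packed // size_map.
by apply: eq_bigr => i _; rewrite /word map_take map_drop.
Qed.

(** * Unit, counit and antipode *)

Section Morphism.
Variable K : fieldType.
Local Notation H := (Hpo K).
Local Notation H' := (WQSymd K).

Lemma orderings0 (V : finType) (F : pforest V) :
  #|V| = 0%N -> orderings F setT = [:: [::]].
Proof.
move=> V0; rewrite /orderings (_ : enum setT = [::]) //.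
by apply: size0nil; rewrite -cardE cardsT.
Qed.

Lemma Phi0 (V : finType) (F : pforest V) :
  #|V| = 0%N -> Phi << class_of F >> = hunit H'.
Proof.
by move=> V0; apply: etrans (Phi_orderings K F) _; rewrite orderings0 // big_seq1.
Qed.

(** The empty forest has the empty word as its only ordering; the words of other forests are
    nonempty. *)
Lemma Phi_counit x : hcounit H' (Phi x) = hcounit H x.
Proof.
move: x; apply: (@malg_linear_eq K _ K^o) => [k u v|k u v|F].
- have -> : Phi (k *: u + v) = k *: Phi u + Phi v by exact: linearP.
  exact: hcounit_is_linear.
- exact: hcounit_is_linear.
rewrite -(class_of_rep F) /= [RHS](linextU (V := K^o)) /= nvert_class_of card_ord.
apply: etrans (congr1 _ (Phi_orderings K (rep F))) _.
rewrite (linear_fun_sum (V := K^o) _ _ (hcounit_is_linear H')).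
have countU s : hcounit H' << pword_pack (map (label (rep F)) s) >> = (size s == 0%N)%:R.
  by rewrite [LHS](linextU (V := K^o)) /= !size_map.
under eq_bigr => s _ do rewrite countU.
have [n0|n_neq0] := eqVneq (nvert F) 0%N; first by rewrite orderings0 ?card_ord // big_seq1.
rewrite big_seq big1 // => s /size_orderings ->.
by rewrite cardsT card_ord (negPf n_neq0).
Qed.

Lemma WQSymd_mul1 x : hmul H' x (hunit H') = x.
Proof.
move: x; apply: malg_linear_eq => [k u v|k u v|s] //; first exact: hmul_is_linear_l.
rewrite hmulU /= (_ : shifted_shuffles _ _ = [:: val s]).
  by rewrite big_seq1; congr << _ >>; apply: val_inj; rewrite /= pack_id ?pwordP.
by rewrite /shifted_shuffles /=; case: (val s).
Qed.

Lemma tens_map_tens (A B C D : choiceType) (f : {linear {malg K[A]} -> {malg K[C]}})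
    (g : {linear {malg K[B]} -> {malg K[D]}}) x y :
  tens_map f g (tens x y) = tens (f x) (g y).
Proof.
move: x; apply: malg_linear_eq => [k u v|k u v|a].
- by rewrite tens_is_linear_l linearP.
- by rewrite linearP tens_is_linear_l.
move: y; apply: malg_linear_eq => [k u v|k u v|b].
- by rewrite !linearP.
- by rewrite linearP tens_is_linear_r.
by rewrite tensU tens_mapU.
Qed.

(** Ranks among packed labels are the labels themselves. This identifies the term of the full ideal
    in the antipode equation. *)
Lemma induced_setT_iso (V : finType) (F : pforest V) : forest_iso (induced F setT) F.
Proof.
apply/forest_isoP; exists val.
  exists (fun v => Sub v (in_setT v)) => [x|v]; last by rewrite SubK.
  by apply: val_inj; rewrite SubK.
split=> x; rewrite ffunE.
  by case: (parent F (val x)) => //= v; rewrite insubT.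
have /eq_in_map rank_id : map (rank_in (codom (label F))) (codom (label F)) =
    map id (codom (label F)) by rewrite map_id [LHS]pack_id ?pforest_packed.
rewrite -[LHS](rank_id _ (codom_f _ _)); apply: eq_rank_in => i.
apply/codomP/imageP => [[v ->]|[y _ ->]]; last by exists (val y).
by exists (Sub v (in_setT v)); rewrite // SubK.
Qed.

(** * Compatibility with the antipodes *)

Section Antipode.
Variables (S : {linear {malg K[forest_class]} -> {malg K[forest_class]}})
  (S' : {linear {malg K[pword]} -> {malg K[pword]}}).
Hypothesis S_antipode : is_antipode H S.
Hypothesis S'_antipode : is_antipode H' S'.

Lemma antipode_ideals (V : finType) (F : pforest V) :
  \sum_(A : {set V} | ideal F A)
    hmul H (S << class_of (induced F A) >>) << class_of (induced F (~: A)) >> =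
  hcounit H << class_of F >> *: hunit H.
Proof.
have [<- _] := S_antipode << class_of F >>.
rewrite Hpo_comul_ideals.
apply/esym/(etrans (congr1 _ (raddf_sum _ _ _ _)))/(etrans (raddf_sum _ _ _ _)).
apply: eq_bigr => A _; apply: etrans (congr1 _ (tens_mapU _ _ _ _)) _.
exact: hmul_tensE.
Qed.

(** The equation of [S'] is taken at the image of the forest; [Phi_comul] then indexes it by the
    same ideals as the equation of [S]. *)
Lemma antipode_Phi_ideals (V : finType) (F : pforest V) :
  \sum_(A : {set V} | ideal F A)
    hmul H' (S' (Phi << class_of (induced F A) >>))
      (Phi << class_of (induced F (~: A)) >>) =
  hcounit H << class_of F >> *: hunit H'.
Proof.
rewrite -Phi_counit; have [<- _] := S'_antipode (Phi << class_of F >>).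
rewrite Phi_comul Hpo_comul_ideals.
apply/esym/(etrans (congr1 (fun z => hmul_tens H' (tens_map S' id z)) (raddf_sum _ _ _ _))).
apply/(etrans (congr1 _ (raddf_sum _ _ _ _)))/(etrans (raddf_sum _ _ _ _)).
apply: eq_bigr => A _.
apply: etrans (congr1 (fun z => hmul_tens H' (tens_map S' id z)) (tens_mapU _ _ _ _)) _.
apply: etrans (congr1 _ (tens_map_tens S' idfun _ _)) _.
exact: hmul_tensE.
Qed.

(* The antipode equation of a forest determines [S] on it from the values on
   the proper ideals, and [Phi] maps it to the antipode equation of the image. *)
Lemma Phi_antipode_class (V : finType) (F : pforest V) :
  Phi (S << class_of F >>) = S' (Phi << class_of F >>).
Proof.
move: {2}#|V| (erefl #|V|) => n; elim/ltn_ind: n => n IHn in V F *; move=> Vn.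
pose R A : {malg K[pword]} := Phi << class_of (induced F (~: A)) >>.
pose T A : {malg K[pword]} := Phi (S << class_of (induced F A) >>).
pose T' A : {malg K[pword]} := S' (Phi << class_of (induced F A) >>).
(* [Phi] carries the equation of [S] to a sum with the same value as that of [S']. *)
have sumTT' : \sum_(A | ideal F A) hmul H' (T A) (R A) =
    \sum_(A | ideal F A) hmul H' (T' A) (R A).
  apply: (etrans _ (esym (antipode_Phi_ideals F))).
  have HZ : Phi (hcounit H << class_of F >> *: hunit H) =
      hcounit H << class_of F >> *: hunit H'.
    by apply: (etrans (linearZZ _ _ _)); congr (_ *: _); apply: Phi0; rewrite card_void.
  rewrite -HZ -antipode_ideals; apply/esym/(etrans (raddf_sum _ _ _ _)).
  by apply: eq_bigr => A _; apply: Phi_mul.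
have idT : ideal F setT by apply/idealP => v w _ _; rewrite inE.
move: sumTT'; rewrite (bigD1 setT) //= [RHS](bigD1 setT) //=.
have -> : \sum_(A | ideal F A && (A != setT)) hmul H' (T A) (R A) =
    \sum_(A | ideal F A && (A != setT)) hmul H' (T' A) (R A).
  (* A proper ideal has fewer vertices than [F], so the induction hypothesis applies. *)
  apply: eq_bigr => A /andP[_ A_proper]; congr (hmul _ _ _).
  apply: (IHn #|{: {v | v \in A}}|) => //; rewrite -Vn card_sig.
  rewrite -[ltnRHS]cardsT (_ : #|_| = #|A|); last by apply: eq_card => v; rewrite inE.
  by apply: proper_card; rewrite properT.
(* Only the terms of the full set remain; their right factor comes from the empty forest. *)
move/addIr; have -> : R setT = hunit H'.
  by apply: Phi0; rewrite card_sig; apply: eq_card0 => v; rewrite !inE.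
rewrite !WQSymd_mul1 /T /T'.
suff -> : class_of (induced F setT) = class_of F by [].
by apply/eqP; rewrite eq_class_of induced_setT_iso.
Qed.

Lemma Phi_antipode x : Phi (S x) = S' (Phi x).
Proof.
move: x; apply: malg_linear_eq => [k u v|k u v|F].
- by rewrite linearP; exact: linearP.
- by rewrite -linearP; congr (S' _); exact: linearP.
by rewrite -(class_of_rep F) Phi_antipode_class.
Qed.

End Antipode.

(** [Phi_basis F] involves only words of length [nvert F], so the coefficient of a word of any other
    length vanishes term by term. *)
Lemma Phi_homogeneous : homogeneous_map0 nvert (fun w : pword => size w) (@Phi K).
Proof.
move=> n x x_n w; rewrite -mcoeff_neq0; apply: contraNeq => w_n.
rewrite /Phi /linext raddf_sum big1_seq // => F /andP[_ /x_n Fn].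
rewrite /= mcoeffZ raddf_sum big1_seq ?mulr0 // => tau /andP[_].
rewrite mem_surj => /eqP tau_n; rewrite [LHS]mcoeffU.
by case: (tau =P w) w_n => // <- /negP[]; apply/eqP; rewrite -Fn.
Qed.

End Morphism.

Theorem mainTheorem2 (K : fieldType) (char0 : [pchar K] =i pred0) :
  is_hopf_morphism (Hpo K) (WQSymd K) (@Phi K) /\
  homogeneous_map0 nvert (fun w : pword => size w) (@Phi K).
Proof.
split; last exact: Phi_homogeneous.
split.
- exact: linext_is_linear.
- by split; [apply: Phi0; rewrite card_void | exact: Phi_mul].
- exact: Phi_counit.
- exact: Phi_comul.
- by move=> S S' S_antipode S'_antipode x; apply: Phi_antipode.
Qed.
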